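(* Let $n\ge 1$. For every $\lambda\ge 0$, the integrated density of states $\mathcal{N}(\lambda)$ for the sub-Laplacian $\Delta_{\mathbb{H}_{n}}$ on the Heisenberg group $\mathbb{H}_{n}$ (as defined in the context by averaging the diagonal of the kernel $\Phi_{\lambda}^{\Delta_{\mathbb{H}_{n}}}$) is given by $$\mathcal{N}(\lambda)=\gamma_{n}\lambda^{n},$$ where $\gamma_{n}>0$ is the constant $$\gamma_{n}=\frac{1}{\pi^{n+\frac12}\,\Gamma(n)}\sum_{j=0}^{+\infty}\frac{\Gamma(j+n)}{j!\,(2j+n)^{n+1}}.$$
   Context: The Heisenberg group $\mathbb{H}_{n}$ is $\mathbb{C}^{n}\times\mathbb{R}$ with group law $(z,\tau)\cdot(w,s)=(z+w,\ \tau+s+2\,\mathrm{Im}\langle z,w\rangle)$, where $\langle z,w\rangle=\sum_{j=1}^{n}z_{j}\overline{w_{j}}$; its Haar measure is Lebesgue measure $d\nu$ on $\mathbb{R}^{2n+1}$. The sub-Laplacian is $$\Delta_{\mathbb{H}_{n}}=\sum_{j=1}^{n}\left[-\frac{\partial^{2}}{\partial z_{j}\partial\overline{z}_{j}}-|z_{j}|^{2}\frac{\partial^{2}}{\partial\tau^{2}}+i\frac{\partial}{\partial\tau}\left(z_{j}\frac{\partial}{\partial z_{j}}-\overline{z}_{j}\frac{\partial}{\partial\overline{z}_{j}}\right)\right].$$ For $\lambda\ge 0$ the kernel used for $\Delta_{\mathbb{H}_{n}}$ (arising from the resolvent kernel as $\mathcal{R}(\zeta;\cdot,\cdot)=\int_{0}^{\infty}\Phi_{\lambda}^{\Delta_{\mathbb{H}_{n}}}(\cdot,\cdot)\frac{d\lambda}{\zeta-\lambda}$,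 and referred to as the kernel of the spectral density operator $dE_{\lambda}/d\lambda$) is the explicit function $$\Phi_{\lambda}^{\Delta_{\mathbb{H}_{n}}}\big((z,\tau),(w,s)\big)=\lambda^{n}\pi^{-n-\frac12}\sum_{j=0}^{+\infty}\frac{\exp\left(\frac{-\rho\lambda}{2(2j+n)}\right)}{(2j+n)^{n+1}}\,L_{j}^{(n-1)}\left(\frac{\lambda\rho}{2j+n}\right)\cos\left(\frac{\theta\lambda}{2(2j+n)}\right),$$ with $\rho=|z-w|^{2}$, $\theta=\tau-s+2\,\mathrm{Im}\langle z,w\rangle$, and Laguerre polynomials $L_{k}^{(\alpha)}(x)=\sum_{j=0}^{k}(-1)^{j}\binom{k+\alpha}{k-j}\frac{x^{j}}{j!}$ ($\alpha>-1$). The integrated density of states is, in this setting, defined as the average over a domain $\Omega\subset\mathbb{H}_{n}$ of finite positive volume of the diagonal values of this kernel (the value does not depend on $\Omega$): $$\mathcal{N}(\lambda):=\frac{1}{\mathrm{Vol}(\Omega)}\int_{\Omega}\Phi_{\lambda}^{\Delta_{\mathbb{H}_{n}}}\big((w,s),(w,s)\big)\,d\nu(w,s).$$ *)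

(* Defs.v *)
From HB Require Import structures.
From mathcomp Require Import all_boot all_order all_algebra.
From mathcomp Require Import all_classical all_reals all_analysis.
From mathcomp Require Import measurable_realfun complex.

Set Implicit Arguments.
Unset Strict Implicit.
Unset Printing Implicit Defensive.

Import Order.TTheory GRing.Theory Num.Theory.
Import numFieldNormedType.Exports.

Local Open Scope classical_set_scope.
Local Open Scope ring_scope.

(* C = R[i] with its norm topology *)
HB.instance Definition _ (R : realType) :=
  PseudoPointedMetric.copy R[i] R[i]^o.

(* the Heisenberg group H_n = C^n x R; its group law is not needed here *)
Definition heis (R : realType) (n : nat) : Type := ('rV[R[i]]_n * R)%type.

HB.instance Definition _ (R : realType) (n : nat) :=
  Topological.copy (heis R n) ('rV[R[i]]_n * R)%type.
HB.instance Definition _ (R : realType) (n : nat) :=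
  Pointed.copy (heis R n) ('rV[R[i]]_n * R)%type.
(* Borel sigma-algebra *)
HB.instance Definition _ (R : realType) (n : nat) :=
  Measurable.copy (heis R n) (g_sigma_algebraType (@open (heis R n))).

Section lebesgue_tuple.
Context {R : realType}.
Local Notation rT := (measurableTypeR R).

Definition tcons k (p : rT * k.-tuple rT) : k.+1.-tuple rT :=
  [tuple of p.1 :: p.2].

Definition tuncons k (t : k.+1.-tuple rT) : rT * k.-tuple rT :=
  (thead t, [tuple of behead t]).

Lemma measurable_tcons k : measurable_fun setT (@tcons k).
Proof. exact: measurable_cons. Qed.

Lemma measurable_tuncons k : measurable_fun setT (@tuncons k).
Proof.
apply: measurable_fun_pair; last exact: measurable_behead.
exact: measurable_tnth.
Qed.

Lemma tconsK k : cancel (@tcons k) (@tuncons k).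
Proof. by case=> x t; congr pair; apply: val_inj. Qed.

Lemma tunconsK k : cancel (@tuncons k) (@tcons k).
Proof. by move=> t; rewrite /tcons /= -tuple_eta. Qed.

Section step.
Local Open Scope ereal_scope.
Variables (k : nat) (m : {sigma_finite_measure set (k.-tuple rT) -> \bar R}).

Definition lebesgue_tupleS : set (k.+1.-tuple rT) -> \bar R :=
  pushforward (lebesgue_measure \x m) (@tcons k).

Let mtcons := @measurable_tcons k.

Let leb0 : lebesgue_tupleS set0 = 0.
Proof. by rewrite /lebesgue_tupleS /pushforward preimage_set0 measure0. Qed.

Let leb_ge0 A : 0 <= lebesgue_tupleS A.
Proof. exact: measure_ge0. Qed.

Let leb_sigma_additive : semi_sigma_additive lebesgue_tupleS.
Proof.
pose mu := measure_function_pushforward__canonical__measure_function_Measure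
  (lebesgue_measure \x m)%E mtcons.
exact: (@measure_semi_sigma_additive _ _ _ mu).
Qed.

HB.instance Definition _ := isMeasure.Build _ _ _ lebesgue_tupleS
  leb0 leb_ge0 leb_sigma_additive.

Let leb_sigma_finite : sigma_finite setT lebesgue_tupleS.
Proof.
have /sigma_finiteP[F [TF ndF Foo]] := sigma_finiteT (@lebesgue_measure R).
have /sigma_finiteP[G [TG ndG Goo]] := sigma_finiteT m.
exists (fun i => @tuncons k @^-1` (F i `*` G i)).
  rewrite -preimage_bigcup predeqE => t; split=> // _ /=.
  have : [set: rT] (tuncons t).1 by [].
  rewrite TF => -[i _ Fi].
  have : [set: k.-tuple rT] (tuncons t).2 by [].
  rewrite TG => -[j _ Gj].
  exists (maxn i j) => //; split.
  - by move: Fi; apply/subsetPset/ndF/leq_maxl.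
  - by move: Gj; apply/subsetPset/ndG/leq_maxr.
move=> i; have [mF Fioo] := Foo i; have [mG Gioo] := Goo i; split.
  rewrite -[X in measurable X]setTI; apply: measurable_tuncons => //.
  exact: measurableX.
rewrite /lebesgue_tupleS /pushforward -comp_preimage.
rewrite (_ : _ \o _ = id); last by apply/funext => p; exact: tconsK.
by rewrite preimage_id product_measure1E// lte_mul_pinfty// ge0_fin_numE.
Qed.

HB.instance Definition _ := Measure_isSigmaFinite.Build _ _ _ lebesgue_tupleS
  leb_sigma_finite.
End step.

(* Lebesgue measure on R^k as an iterated product, characterised by its values
   on boxes (lebesgue_tuple_box); mathcomp-analysis only has it for k = 1 *)
Fixpoint lebesgue_tuple k :
  {sigma_finite_measure set (k.-tuple rT) -> \bar R} :=
  match k with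
  | 0%N => dirac [tuple]
  | k'.+1 => lebesgue_tupleS (lebesgue_tuple k')
  end.

Lemma lebesgue_tuple_box k (A : 'I_k -> set rT) :
  (forall i, measurable (A i)) ->
  (lebesgue_tuple k [set t | forall i, A i (tnth t i)] =
   \prod_(i < k) lebesgue_measure (A i))%E.
Proof.
elim: k A => [|k IH] A mA.
  rewrite big_ord0 /= diracE mem_set//; by case.
rewrite big_ord_recl -IH//= -product_measure1E//; last first.
  rewrite (_ : [set _ | _] = \bigcap_(i in [set: 'I_k]) ((fun t : k.-tuple rT => tnth t i) @^-1` A (lift ord0 i))).
    apply: fin_bigcap_measurable => // i _.
    rewrite -[X in measurable X]setTI; exact: measurable_tnth.
  by apply/seteqP; split=> t /= h => [i _|i]; [exact: h|exact: (h i)].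
rewrite /lebesgue_tupleS /pushforward; congr product_measure1.
apply/seteqP; split=> -[x t] /=.
  move=> h; split; first exact: (h ord0).
  by move=> i; have := h (lift ord0 i); rewrite tnthS /=; congr (A _ _); congr tnth; apply: val_inj.
move=> [h0 h] i; case: (unliftP ord0 i) => [j|] ->//.
by rewrite tnthS; have := h j; congr (A _ _); congr tnth; apply: val_inj.
Qed.

Definition tuple_row k (t : k.-tuple rT) : 'rV[R]_k := \row_i tnth t i.

Lemma measurable_preimage_tuple_row k (V : set 'rV[R]_k) :
  open V -> measurable (@tuple_row k @^-1` V).
Proof.
move=> oV.
pose B (qr : 'rV[rat]_k * rat) : set (k.-tuple rT) :=
  [set t | forall i, ball (ratr (qr.1 ord0 i) : R) (ratr qr.2) (tnth t i)].
pose D := [set qr : 'rV[rat]_k * rat | B qr `<=` @tuple_row k @^-1` V].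
rewrite (_ : _ @^-1` _ = \bigcup_(qr in D) B qr).
  rewrite bigcup_mkcond; apply: countable_bigcupT_measurable => // qr.
  case: ifP => // _.
  rewrite (_ : B qr = \bigcap_(i in [set: 'I_k]) ((fun t : k.-tuple rT => tnth t i) @^-1` ball (ratr (qr.1 ord0 i) : R) (ratr qr.2))).
    apply: fin_bigcap_measurable => // i _.
    rewrite -[X in measurable X]setTI; apply: measurable_tnth => //.
    by apply: open_measurable; exact: ball_open.
  by apply/seteqP; split=> t /= h => [i _|i]; [exact: h|exact: (h i)].
apply/seteqP; split=> [t Vt|t [qr Dqr] /Dqr//].
move: (oV); rewrite openE => /(_ _ Vt); rewrite /interior => /nbhs_ballP[e /= e0 eV].
have [r /andP[r0 re]] : exists r : rat, 0 < (ratr r : R) < e / 2.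
  have [r] := @rat_in_itvoo R 0 (e / 2) (divr_gt0 e0 (ltr0Sn R 1)).
  by rewrite in_itv /= => h; exists r.
have /choice[q qP] : forall i, exists q : rat, ball (tnth t i : R) (ratr r) (ratr q).
  move=> i; have [|q] := @rat_in_itvoo R (tnth t i - ratr r) (tnth t i + ratr r).
    by rewrite ltrD2l gtrN.
  rewrite in_itv /= => h; exists q.
  by rewrite /ball /= ltr_distlC.
exists (\row_i q i, r) => /=.
  move=> s /= Bs; apply: eV; split=> // i j; rewrite ord1 !mxE.
  apply: (@le_ball _ _ _ (ratr r + ratr r)); first by rewrite [leRHS]splitr lerD// ltW.
  apply: ball_triangle (qP _) _.
  by have := Bs j; rewrite mxE.
by move=> i; rewrite mxE; exact: ball_sym.
Qed.

End lebesgue_tuple.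

Section heis_measure.
Variables (R : realType) (n : nat).

(* identification R^(2n+1) = C^n x R, (x, y, t) |-> (x + iy, t) *)
Definition heis_of_row (v : 'rV[R]_(n + n + 1)) : heis R n :=
  (\row_j (v ord0 (lshift 1 (lshift n j)) +i* v ord0 (lshift 1 (rshift n j)))%C,
   v ord0 (rshift (n + n) ord0)).

Lemma continuous_heis_of_row : continuous heis_of_row.
Proof.
suff H : forall (v : 'rV[R]_(n + n + 1)) (A : set (heis R n)),
    nbhs (heis_of_row v) A -> nbhs v (heis_of_row @^-1` A).
  by move=> v A; exact: H.
move=> v.
have cv m (i : 'I_m) (w : 'rV[R]_m) (e : R) : 0 < e ->
    nbhs w [set x : 'rV[R]_m | `|w ord0 i - x ord0 i| < e].
  move=> e0; apply/nbhs_ballP; exists e => //= x [_ /(_ ord0 i)].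
  by rewrite /ball /=.
move=> A [[M Q] [/= [P nP PM] nQ] MQA].
have cQ : nbhs v [set w : 'rV[R]_(n + n + 1) | Q (w ord0 (rshift (n + n) ord0))].
  move: nQ => /nbhs_ballP[e /= e0 eQ].
  by apply: filterS (cv _ (rshift (n + n) ord0) v e e0) => w /= ?; exact: eQ.
have key i j : nbhs v [set w : 'rV[R]_(n + n + 1) | P i j
    ((\row_j (w ord0 (lshift 1 (lshift n j)) +i*
               w ord0 (lshift 1 (rshift n j)))%C) i j)].
  have := nP i j; rewrite !mxE => /nbhs_ballP[e /= e0].
  have er : (complex.Re e)%:C%C = e.
    by case: e e0 => a b; rewrite ltcE /= => /andP[/eqP -> _].
  have r0 : 0 < complex.Re e by move: e0; rewrite -er ltcR.
  set r := complex.Re e in er r0 *.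
  have r20 : 0 < r / 2 by rewrite divr_gt0.
  move=> eP; near=> w.
  apply: eP; rewrite mxE /ball /= -er.
  have ha : `|v ord0 (lshift 1 (lshift n j)) - w ord0 (lshift 1 (lshift n j))|
      < r / 2 by near: w; exact: cv.
  have hb : `|v ord0 (lshift 1 (rshift n j)) - w ord0 (lshift 1 (rshift n j))|
      < r / 2 by near: w; exact: cv.
  move: ha hb; set a1 := v _ _; set a2 := w _ _ => ha.
  set b1 := v _ _; set b2 := w _ _ => hb.
  rewrite (_ : _ - _ = (a1 - a2)%:C%C + (0 +i* (b1 - b2))%C); last first.
    by apply/eqP; rewrite eq_complex /= add0r addr0 !eqxx.
  apply: (le_lt_trans (ler_normD _ _)).
  rewrite !normc_def /= expr0n addr0 add0r !sqrtr_sqr -rmorphD /= ltcR.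
  by rewrite [ltRHS]splitr ltrD.
have cP : nbhs v [set w : 'rV[R]_(n + n + 1) | forall i j, P i j
    ((\row_j (w ord0 (lshift 1 (lshift n j)) +i*
               w ord0 (lshift 1 (rshift n j)))%C) i j)].
  exact: filter_forall _ (fun i => filter_forall _ (key i)).
have FF : Filter (nbhs v) := @nbhs_filter ('rV[R]_(n + n + 1) : topologicalType) v.
apply: filterS2 cP cQ => w Pw Qw; apply: (MQA (heis_of_row w)).
by split => //=; exact: PM.
Unshelve. all: by end_near. Qed.

Definition heis_of_tuple := heis_of_row \o @tuple_row R (n + n + 1).

Lemma measurable_heis_of_tuple : measurable_fun setT heis_of_tuple.
Proof.
apply: (@measurability _ _ _ _ _ _ (@open (heis R n))) => //.
move=> _ [A oA <-]; rewrite setTI comp_preimage.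
apply: measurable_preimage_tuple_row; apply: open_comp => // v _.
exact: continuous_heis_of_row.
Qed.

Local Open Scope ereal_scope.
Definition heis_measure : set (heis R n) -> \bar R :=
  pushforward (lebesgue_tuple (n + n + 1)) heis_of_tuple.

Let mheis := measurable_heis_of_tuple.

Let nu0 : heis_measure set0 = 0.
Proof. by rewrite /heis_measure /pushforward preimage_set0 measure0. Qed.

Let nu_ge0 A : 0 <= heis_measure A.
Proof. exact: measure_ge0. Qed.

Let nu_sigma_additive : semi_sigma_additive heis_measure.
Proof.
pose mu := measure_function_pushforward__canonical__measure_function_Measure
  (lebesgue_tuple (n + n + 1)) mheis.
exact: (@measure_semi_sigma_additive _ _ _ mu).
Qed.

HB.instance Definition _ := isMeasure.Build _ _ _ heis_measure
  nu0 nu_ge0 nu_sigma_additive.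
End heis_measure.

Section heis_ids.
Variable R : realType.

Definition hdot (n : nat) (z w : 'rV[R[i]]_n) : R[i] :=
  \sum_(j < n) z ord0 j * conjc (w ord0 j).

(* <z, z> is real: this is |z|^2 *)
Definition sqnorm (n : nat) (z : 'rV[R[i]]_n) : R := complex.Re (hdot z z).

Definition Gamma (x : R) : R :=
  \int[lebesgue_measure]_(t in `]0, +oo[) (t `^ (x - 1) * expR (- t)).

(* generalized binomial coefficient a (a - 1) ... (a - k + 1) / k! *)
Definition gbinom (a : R) (k : nat) : R :=
  (\prod_(i < k) (a - i%:R)) / k`!%:R.

Definition laguerre (k : nat) (a x : R) : R :=
  \sum_(j < k.+1) (-1) ^+ j * gbinom (k%:R + a) (k - j) * (x ^+ j / j`!%:R).

Definition heis_rho (n : nat) (p q : heis R n) : R := sqnorm (p.1 - q.1).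

Definition heis_theta (n : nat) (p q : heis R n) : R :=
  p.2 - q.2 + 2 * complex.Im (hdot p.1 q.1).

Definition heis_kernel_term (n : nat) (lambda : R) (p q : heis R n)
    (j : nat) : R :=
  let rho := heis_rho p q in
  let theta := heis_theta p q in
  let d : R := (2 * j + n)%:R in
  expR (- (rho * lambda) / (2 * d)) / d ^+ n.+1 *
  laguerre j (n%:R - 1) (lambda * rho / d) *
  cos (theta * lambda / (2 * d)).

(* the kernel Phi_lambda of dE_lambda / dlambda for the sub-Laplacian of H_n *)
Definition heis_kernel (n : nat) (lambda : R) (p q : heis R n) : R :=
  lambda ^+ n * pi `^ (- n%:R - 2^-1) *
  limn (series (heis_kernel_term lambda p q)).

(* integrated density of states, averaged over Omega *)
Definition heis_ids (n : nat) (Omega : set (heis R n)) (lambda : R) : \bar R :=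
  (((fine (heis_measure Omega))^-1)%:E *
   \int[@heis_measure R n]_(p in Omega) (heis_kernel lambda p p)%:E)%E.

Definition gamma_term (n : nat) (j : nat) : R :=
  Gamma (j + n)%:R / (j`!%:R * (2 * j + n)%:R ^+ n.+1).

Definition gamma_const (n : nat) : R :=
  1 / (pi `^ (n%:R + 2^-1) * Gamma n%:R) * limn (series (gamma_term n)).

End heis_ids.

(* Main.v *)
(* On the diagonal rho = theta = 0 and L_j^(n-1)(0) = Gamma(j+n) / (Gamma(n) j!),
   so the kernel is the constant gamma_n lambda^n and so is its average. The
   series converges because (j+n-1)!/j! <= (2j+n)^(n-1), which bounds its terms
   by (2j+n)^-2. *)
Require Import Defs.
From mathcomp Require Import all_boot all_order all_algebra.
From mathcomp Require Import all_classical all_reals all_analysis.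
From mathcomp Require Import measurable_realfun complex ring zify.
Import Order.TTheory GRing.Theory Num.Theory.
Import numFieldNormedType.Exports.
Local Open Scope classical_set_scope.
Local Open Scope ring_scope.

(** A single term of the exponential series suffices: $e^x\ge x^{n+1}/(n+1)!$ squeezes the function
    between $0$ and $(n+1)!/x$. *)
Lemma cvgy_exprn_expRN (R : realType) (n : nat) :
  (x ^+ n * expR (- x)) @[x --> +oo%R] --> (0 : R).
Proof.
have K0 : 0 < (n.+1)`!%:R :> R by rewrite ltr0n fact_gt0.
have Vy : (n.+1)`!%:R * x^-1 @[x --> +oo%R] --> (0 : R).
  rewrite -[X in _ --> X](mulr0 ((n.+1)`!%:R : R)); apply: cvgMl_tmp => //.
  by apply/(gtr0_cvgV0 (f := fun x : R => x)); [exact: nbhs_pinfty_gt|exact: cvg_id].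
apply: (squeeze_cvgr _ (cvg_cst 0) Vy).
near=> x.
have x0 : 0 < x by near: x; exact: nbhs_pinfty_gt.
rewrite mulr_ge0 ?expR_ge0 ?exprn_ge0 ?(ltW x0)//=.
rewrite ler_pdivlMr// mulrAC -exprSr expRN ler_pdivrMr ?expR_gt0//.
rewrite mulrC -ler_pdivrMr//.
by apply: le_trans (expR_ge1Dxn n (ltW x0)); rewrite lerDr.
Unshelve. all: by end_near. Qed.

(** Supplies what the fundamental theorem of calculus on $[0,+\infty[$ needs to evaluate
    $\Gamma(n+1)$ as $0-F(0)$. *)
Lemma exprn_expRN_antiderivative (R : realType) (n : nat) :
  exists F : R -> R, [/\ F 0 = - n`!%:R, F x @[x --> +oo%R] --> 0 &
    forall x : R, is_derive x 1 F (x ^+ n * expR (- x))].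
Proof.
elim: n => [|n [F [F0 Fy dF]]].
  exists (fun x => - expR (- x)); split=> [||x].
  - by rewrite oppr0 expR0.
  - by rewrite -oppr0; apply: cvgN; exact: cvgr_expR.
  - by apply: is_derive_eq; rewrite expr0 mul1r /GRing.scale/=; ring.
(* Integration by parts, $F$ being the antiderivative for exponent $n$. *)
exists (fun x => n.+1%:R * F x - x ^+ n.+1 * expR (- x)); split=> [||x].
- by rewrite F0 expr0n mul0r subr0 factS natrM mulrN.
- rewrite -[X in _ --> X](_ : n.+1%:R * 0 - 0 = 0 :> R); last by rewrite mulr0 subr0.
  apply: cvgB; first exact: cvgMl_tmp.
  exact: cvgy_exprn_expRN.
- have dE : is_derive x 1 (fun y : R => expR (- y)) (- expR (- x)).
    by apply: is_derive_eq; rewrite /GRing.scale/=; ring.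
  have dX : is_derive x 1 (fun y : R => y ^+ n.+1) (n.+1%:R * x ^+ n).
    have -> : (fun y : R => y ^+ n.+1) = id ^+ n.+1.
      by apply/funext => y; rewrite exprfctE.
    apply: (is_derive_eq (is_deriveX _ (is_derive_id x 1))).
    by rewrite /GRing.scale/= mulr1.
  apply: (is_derive_eq (is_deriveB (is_deriveZ n.+1%:R (dF x)) (is_deriveM dX dE))).
  by rewrite /GRing.scale/= exprS; ring.
Qed.

Lemma Gamma_natS (R : realType) (n : nat) : Gamma n.+1%:R = n`!%:R :> R.
Proof.
have [F [F0 Fy dF]] := exprn_expRN_antiderivative R n.
have cf : continuous (fun x : R => x ^+ n * expR (- x)).
  move=> x; apply: cvgM; first exact: exprn_continuous.
  by apply: continuous_comp; [exact: opp_continuous|exact: continuous_expR].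
have Fc (x : R) : {for x, continuous F}.
  by apply: differentiable_continuous; apply/derivable1_diffP; have [] := dF x.
transitivity (\int[@lebesgue_measure R]_(x in `]0, +oo[) (x ^+ n * expR (- x))).
  apply: eq_Rintegral => x; rewrite inE/= in_itv/= andbT => x0.
  by rewrite -natr1 addrK powR_mulrn// ltW.
(* Adding the null point $0$ gives the closed half-line on which the fundamental theorem is
   applied. *)
rewrite /Rintegral integral_itv_obnd_cbnd; last first.
  by apply/measurable_EFinP; apply: measurable_funTS; exact: continuous_measurable_fun.
rewrite -/(Rintegral _ _ _) (@Rintegral_ge0_continuous_FTC2y _ _ F _ 0).
- by rewrite F0 opprK add0r.
- by move=> x x0; rewrite mulr_ge0 ?expR_ge0 ?exprn_ge0.
- exact: continuous_subspaceT.
- exact: Fy.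
- by move=> x _; have [] := dF x.
- exact: cvg_at_right_filter (Fc 0).
- by move=> x _; rewrite derive1E; have [] := dF x.
Qed.

(** The quotient $(j+n)!/j!$ is a product of $n$ factors, each at most $j+n$. *)
Lemma fact_leq_expn (j n : nat) : ((j + n)`! <= j`! * (j + n) ^ n)%N.
Proof.
elim: n => [|n IH]; first by rewrite addn0 expn0 muln1.
rewrite addnS factS expnS mulnCA leq_mul2l/=.
rewrite (leq_trans IH)// leq_mul2l; apply/orP; right.
by case: n {IH} => // n; rewrite leq_exp2r// leq_add2l.
Qed.

(** From here on the dimension is written [n.+1], so that the Gamma values become factorials. *)
Lemma gamma_termE (R : realType) (n j : nat) :
  gamma_term R n.+1 j = (j + n)`!%:R / (j`!%:R * (2 * j + n.+1)%:R ^+ n.+2).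
Proof. by rewrite /gamma_term addnS Gamma_natS. Qed.

Lemma gamma_term_gt0 (R : realType) (n j : nat) : 0 < gamma_term R n.+1 j.
Proof.
have d0 : 0 < (2 * j + n.+1)%:R :> R by rewrite ltr0n addnS.
have fact0 k : 0 < k`!%:R :> R by rewrite ltr0n fact_gt0.
by rewrite gamma_termE; apply: divr_gt0 => //; apply: mulr_gt0 => //; exact: exprn_gt0.
Qed.

Lemma nondecreasing_series_gamma_term (R : realType) (n : nat) :
  nondecreasing_seq (series (gamma_term R n.+1)).
Proof.
apply/nondecreasing_seqP => k.
by rewrite /series/= big_nat_recr//= lerDl ltW// gamma_term_gt0.
Qed.

(* The right-hand side telescopes, so the partial sums are at most 2. *)
Lemma gamma_term_le (R : realType) (n j : nat) :
  gamma_term R n.+1 j <= 2 / j.+1%:R - 2 / j.+2%:R.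
Proof.
have -> : 2 / j.+1%:R - 2 / j.+2%:R = 2 / (j.+1 * j.+2)%:R :> R.
  by rewrite natrM -[j.+2%:R]natr1; field; rewrite nat1r natr1 !pnatr_eq0.
rewrite gamma_termE ler_pdivrMr; last first.
  by rewrite mulr_gt0 ?exprn_gt0 ?ltr0n ?fact_gt0// addnS.
rewrite mulrAC ler_pdivlMr ?ltr0n ?muln_gt0//.
rewrite -natrX -!natrM ler_nat.
(* With $d=2j+n+1$, the claim is now $(j+n)!\,(j+1)(j+2)\le 2\,j!\,d^{n+2}$. It is the product of
   $(j+n)!\le j!\,d^n$ and $(j+1)(j+2)\le 2d^2$; equality at $j=n=0$ fixes the constant $2$. *)
have H1 := fact_leq_expn j n.
have H2 : ((j + n) ^ n <= (2 * j + n.+1) ^ n)%N by case: n {H1} => // n; rewrite leq_exp2r//; lia.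
have H3 : (j.+1 * j.+2 <= 2 * (2 * j + n.+1) ^ 2)%N by nia.
have := leq_mul (leq_trans H1 (leq_mul (leqnn _) H2)) H3.
move/leq_trans; apply; apply: eq_leq.
by rewrite -[n.+2]addn2 expnD; ring.
Qed.

Lemma is_cvg_series_gamma_term (R : realType) (n : nat) :
  cvgn (series (gamma_term R n.+1)).
Proof.
apply: nondecreasing_is_cvgn; first exact: nondecreasing_series_gamma_term.
(* The sharper bound $2-2/(N+1)$ on the partial sums is the one that passes through the
   induction. *)
exists 2 => _ [N _ <-]; apply: (@le_trans _ _ (2 - 2 / N.+1%:R)); last first.
  by rewrite gerBl divr_ge0.
elim: N => [|N IH]; first by rewrite /series/= big_geq// divr1 subrr.
rewrite /series/= big_nat_recr//=.
by have := lerD IH (gamma_term_le R n N); rewrite addrA subrK.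
Qed.

(** The limit of the nondecreasing partial sums is at least the first term, which is positive. *)
Lemma gamma_const_gt0 (R : realType) (n : nat) : 0 < gamma_const R n.+1.
Proof.
rewrite /gamma_const Gamma_natS mulr_gt0//.
  by rewrite divr_gt0// mulr_gt0 ?powR_gt0 ?pi_gt0// ltr0n fact_gt0.
apply: (@lt_le_trans _ _ (series (gamma_term R n.+1) 1%N)).
  by rewrite /series/= big_nat1 gamma_term_gt0.
apply: nondecreasing_cvgn_le; first exact: nondecreasing_series_gamma_term.
exact: is_cvg_series_gamma_term.
Qed.

(** At $0$ only the constant term $\binom{k+n}{k}$ survives; its numerator is the falling factorial
    $(k+n)!/n!$. *)
Lemma laguerre0 (R : realType) (k n : nat) :
  laguerre k (n.+1%:R - 1) 0 = (k + n)`!%:R / (n`!%:R * k`!%:R) :> R.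
Proof.
rewrite /laguerre big_ord_recl big1 ?addr0 => [|i _]; last first.
  by rewrite lift0 expr0n mul0r mulr0.
rewrite /= expr0 fact0 divr1 mulr1 mul1r subn0 /gbinom -natr1 addrK -natrD.
have -> : \prod_(i < k) ((k + n)%:R - i%:R) = ((k + n) ^_ k)%:R :> R.
  rewrite ffact_prod natr_prod; apply: eq_bigr => i _.
  by rewrite natrB// (leq_trans (ltnW (ltn_ord i))) ?leq_addr.
rewrite -(@ffact_fact (k + n) k) ?leq_addr// addKn natrM.
by rewrite invfM mulrA mulfK// pnatr_eq0 -lt0n fact_gt0.
Qed.

Lemma heis_rho_diag (R : realType) (n : nat) (p : heis R n) : heis_rho p p = 0.
Proof.
rewrite /heis_rho /sqnorm /hdot subrr big1// => i _.
by rewrite mxE mul0r.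
Qed.

Lemma heis_theta_diag (R : realType) (n : nat) (p : heis R n) :
  heis_theta p p = 0.
Proof.
rewrite /heis_theta subrr add0r /hdot.
suff -> : complex.Im (\sum_(j < n) p.1 ord0 j * conjc (p.1 ord0 j)) = 0.
  by rewrite mulr0.
rewrite raddf_sum big1//= => i _; case: (p.1 ord0 i) => a b /=; ring.
Qed.

(** An equality of sequences, so that the factor $1/\Gamma(n+1)$ can leave the limit of the
    series. *)
Lemma heis_kernel_term_diag (R : realType) (n : nat) (lambda : R)
    (p : heis R n.+1) :
  heis_kernel_term lambda p p = (Gamma n.+1%:R)^-1 *: gamma_term R n.+1.
Proof.
apply/funext => j; rewrite /heis_kernel_term heis_rho_diag heis_theta_diag.
rewrite !(mul0r, mulr0, oppr0) expR0 cos0 laguerre0 mulr1.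
rewrite fctE /= gamma_termE Gamma_natS /GRing.scale/=.
have j0 : j`!%:R != 0 :> R by rewrite pnatr_eq0 -lt0n fact_gt0.
have n0 : n`!%:R != 0 :> R by rewrite pnatr_eq0 -lt0n fact_gt0.
have d0 : (2 * j + n.+1)%:R ^+ n.+2 != 0 :> R.
  by rewrite expf_neq0// pnatr_eq0 addnS.
by move: j0 n0 d0; set d := _ ^+ _ => *; field; apply/and3P.
Qed.

Lemma heis_kernel_diag (R : realType) (n : nat) (lambda : R)
    (p : heis R n.+1) :
  heis_kernel lambda p p = gamma_const R n.+1 * lambda ^+ n.+1.
Proof.
rewrite /heis_kernel heis_kernel_term_diag lim_seriesZ; last first.
  exact: is_cvg_series_gamma_term.
rewrite /gamma_const -opprD powRN /GRing.scale/= div1r invfM; ring.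
Qed.

Theorem proposition4p1 (R : realType) (n : nat) (n_ge1 : (1 <= n)%N) :
  [/\ cvgn (series (gamma_term R n)),
      0 < gamma_const R n
    & forall (Omega : set (heis R n)) (lambda : R),
        open Omega -> connected Omega ->
        (0 < heis_measure Omega < +oo)%E ->
        0 <= lambda ->
        heis_ids Omega lambda = (gamma_const R n * lambda ^+ n)%:E].
Proof.
case: n n_ge1 => // n _; split.
- exact: is_cvg_series_gamma_term.
- exact: gamma_const_gt0.
move=> Omega lambda oO _ /andP[vol_gt0 vol_fin] _.
rewrite /heis_ids; under eq_integral do rewrite heis_kernel_diag.
(* The integrand is constant, and [Omega], being open, is a generator of the Borel sigma-algebra. *)
rewrite integral_cst/=; last exact: sub_sigma_algebra.
(* Only a finite positive volume [m] remains, and it cancels against its inverse. *)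
move: vol_gt0 vol_fin; case: (heis_measure Omega) => [m| |]//=.
rewrite lte_fin => m0 _; rewrite -!EFinM; congr EFin.
by rewrite mulrCA mulVf ?mulr1// gt_eqF.
Qed.
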